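(* If $\lim_{n\to\infty}\frac{f_n}{p_n}=3$, then every sufficiently large even number $x$ can be written as a sum $x=p+q$ of prime numbers $p,q$. Moreover, the prime number $p$ can be chosen such that $\frac x4<p\leq\frac x2$.
   Context: Let $p_1=2,p_2=3,p_3=5,\ldots$ be the prime numbers in increasing order. For $n\ge1$ let $S_n\subseteq\mathbb{N}$ be the numerical semigroup generated by all primes not less than $p_n$ (i.e. the set of all finite sums, including the empty sum $0$, of primes $\ge p_n$); its complement in $\mathbb{N}$ is finite. The Frobenius number $f_n$ of $S_n$ is the largest integer not contained in $S_n$. *)

(* Defs.v *)
From mathcomp Require Import all_boot all_order all_algebra.
From mathcomp Require Import boolp classical_sets reals topology normedtype sequences.

Set Implicit Arguments.
Unset Strict Implicit.
Unset Printing Implicit Defensive.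

Local Open Scope nat_scope.

Lemma ex_next_prime (m : nat) : exists q, prime q && (m < q).
Proof. by have [q lt_mq pr_q] := prime_above m; exists q; rewrite pr_q. Qed.

Definition next_prime (m : nat) : nat := ex_minn (ex_next_prime m).

(* [nth_prime] is indexed from 1: [nth_prime 1 = 2], [nth_prime 2 = 3], ...;
   the value [nth_prime 0 = 0] is a convention. *)
Definition nth_prime (n : nat) : nat := iter n next_prime 0.

Definition prime_semigroup (n : nat) : set nat :=
  [set m | exists2 s : seq nat,
     {in s, forall q, prime q && (nth_prime n <= q)} & m = sumn s]%classic.

Definition is_largest_gap (S : set nat) (f : nat) : Prop :=
  ~ S f /\ forall m, ~ S m -> m <= f.

(* The default value 0 is never used for [S = prime_semigroup n]: see
   [frobenius_numberP]. Since 1 is not in [prime_semigroup n], the largest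
   integer outside it is a natural number. *)
Definition frobenius_number (S : set nat) : nat :=
  xget 0 [set f | is_largest_gap S f]%classic.

Lemma prime_nth_prime (n : nat) : 0 < n -> prime (nth_prime n).
Proof.
case: n => // n _; rewrite /nth_prime iterS /next_prime.
by case: ex_minnP => q /andP[].
Qed.

Lemma nth_prime_lt (n : nat) : nth_prime n < nth_prime n.+1.
Proof.
rewrite {2}/nth_prime iterS /next_prime.
by case: ex_minnP => q /andP[].
Qed.

Lemma nth_prime_gap (n q : nat) :
  prime q -> nth_prime n < q -> nth_prime n.+1 <= q.
Proof.
move=> pr_q lt_nq; rewrite {1}/nth_prime iterS /next_prime.
by case: ex_minnP => r _; apply; rewrite pr_q.
Qed.

Lemma nth_prime1 : nth_prime 1 = 2.
Proof.
apply/eqP; rewrite eqn_leq nth_prime_gap //.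
by apply: prime_gt1; exact: prime_nth_prime.
Qed.

Lemma prime_semigroup_cofinite (n m : nat) : 0 < n ->
  nth_prime n * nth_prime n.+1 <= m -> prime_semigroup n m.
Proof.
move=> n_gt0; have pr_p := prime_nth_prime n_gt0.
have pr_r : prime (nth_prime n.+1) by exact: prime_nth_prime.
have lt_pr := nth_prime_lt n.
have memP a b : prime_semigroup n (a * nth_prime n + b * nth_prime n.+1).
  exists (nseq a (nth_prime n) ++ nseq b (nth_prime n.+1)); last first.
    by rewrite sumn_cat !sumn_nseq mulnC [in X in _ + X]mulnC.
  move=> q; rewrite mem_cat !mem_nseq.
  by case/orP=> /andP[_ /eqP->]; rewrite ?pr_p ?pr_r //= ltnW.
move: (nth_prime n) (nth_prime n.+1) pr_p pr_r lt_pr memP.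
move=> p r pr_p pr_r lt_pr memP le_m.
have p_gt0 := prime_gt0 pr_p.
have cop : coprime p r by rewrite prime_coprime // dvdn_prime2 // neq_ltn lt_pr.
pose c := chinese p r 0 m.
have c0 : c = 0 %[mod p] by rewrite chinese_modl.
have cm : c = m %[mod r] by rewrite chinese_modr.
pose d := c %% (p * r).
have d_lt : d < p * r by rewrite ltn_mod muln_gt0 p_gt0 prime_gt0.
have pd : p %| d.
  by rewrite /dvdn /d modn_dvdm ?dvdn_mulr // c0 mod0n.
have dm : d = m %[mod r] by rewrite /d modn_dvdm ?dvdn_mull.
have le_dm : d <= m := ltnW (leq_trans d_lt le_m).
have rd : r %| m - d by rewrite -eqn_mod_dvd //; apply/eqP.
by have := memP (d %/ p) ((m - d) %/ r); rewrite !divnK // subnKC.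
Qed.

Lemma prime_semigroup1 (n : nat) : 0 < n -> ~ prime_semigroup n 1.
Proof.
move=> n_gt0 [[|q s] //= sP].
have /andP[/prime_gt1 q_gt1 _] := sP q (mem_head _ _).
by move=> eq1; have := leq_addr (sumn s) q; rewrite -eq1 leqNgt q_gt1.
Qed.

Lemma frobenius_numberP (n : nat) : 0 < n ->
  is_largest_gap (prime_semigroup n) (frobenius_number (prime_semigroup n)).
Proof.
move=> n_gt0; rewrite /frobenius_number; case: xgetP => [f _ //|noF].
have exG : exists m, `[< ~ prime_semigroup n m >].
  by exists 1; apply/asboolP; exact: prime_semigroup1.
have ubG m : `[< ~ prime_semigroup n m >] -> m <= nth_prime n * nth_prime n.+1.
  move/asboolP=> nSm; rewrite leqNgt; apply/negP => /ltnW le_m.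
  exact/nSm/prime_semigroup_cofinite.
case: (ex_maxnP exG ubG) => f /asboolP nSf maxf.
by case: (noF f); split=> // m nSm; apply/maxf/asboolP.
Qed.

(* Main.v *)
Require Import Defs.
From mathcomp Require Import all_boot all_order all_algebra.
From mathcomp Require Import boolp classical_sets reals topology normedtype sequences.
From mathcomp Require Import zify ring lra.
Import Order.TTheory GRing.Theory Num.Theory.
Import numFieldNormedType.Exports.

(* An even [x] lying in [prime_semigroup n] with [x / 4 < nth_prime n] is a sum
   of at most three odd primes, hence of exactly two. Since the Frobenius number
   is eventually below [61 / 20 * nth_prime n], it suffices to find a prime
   between [x / 4] and [(13 / 10) * (x / 4)].

   The quotient [(30n)! n! / ((15n)! (10n)! (6n)!)] is an integer which divides
   the lcm of [1, ..., 30n] and is divisible by all primes in [(5n, 30n]].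
   It grows like [K^n], so the logarithm of the primorial of [y] lies
   asymptotically between [ln K / 30 * y] and [6 / 5 * (ln K / 30) * y]; every
   ratio above [6 / 5] therefore forces a prime in the interval. *)

Set Implicit Arguments.
Unset Strict Implicit.
Unset Printing Implicit Defensive.

Local Open Scope nat_scope.

(** * Primorials, prime valuations and Legendre's formula *)

Definition primorial (n : nat) : nat := \prod_(1 <= p < n.+1 | prime p) p.

Lemma dvdn_logn (m n : nat) : 0 < m -> 0 < n ->
  (forall p, prime p -> logn p m <= logn p n) -> m %| n.
Proof.
move=> m_gt0 n_gt0 le_mn; apply/dvdn_partP => // p /=.
rewrite mem_primes => /andP[pr_p _].
by rewrite p_part pfactor_dvdn // le_mn.
Qed.

Lemma sum_nat_leq (m t : nat) : \sum_(1 <= k < m.+1) (k <= t) = minn m t.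
Proof.
elim: m => [|m IHm]; first by rewrite big_nil min0n.
by rewrite big_nat_recr //= IHm; lia.
Qed.

Lemma prod_primes_gt0 (e : nat -> nat) (m n : nat) :
  0 < \prod_(m <= q < n | prime q) q ^ e q.
Proof. by apply: prodn_cond_gt0 => q /prime_gt0 q_gt0; rewrite expn_gt0 q_gt0. Qed.

Lemma logn_prod_primes (e : nat -> nat) (m n p : nat) : prime p ->
  logn p (\prod_(m <= q < n | prime q) q ^ e q) = (m <= p < n) * e p.
Proof.
move=> pr_p; elim: n => [|n IHn]; first by rewrite big_geq // logn1 andbF.
case: (leqP m n) => [le_mn|lt_nm]; last first.
  by rewrite big_geq // logn1; case: andP => // -[]; lia.
rewrite big_mkcond big_nat_recr //= -big_mkcond /=.
case: ifP => [pr_n|npr_n]; last first.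
  rewrite muln1 IHn; have: p != n by apply: contraFneq npr_n => <-.
  lia.
rewrite lognM ?prod_primes_gt0 ?expn_gt0 ?prime_gt0 // IHn lognX logn_prime //.
case: eqP => [->|/eqP ne_pn]; lia.
Qed.

(** Legendre's formula with a free upper limit [m]: the terms beyond [n] vanish, so factorials of
    different sizes can share one range of summation. *)
Lemma logn_factE (p n m : nat) : prime p -> n <= m ->
  logn p n`! = \sum_(1 <= k < m.+1) n %/ p ^ k.
Proof.
move=> pr_p le_nm; rewrite logn_fact //.
rewrite [RHS](big_cat_nat (n := n.+1)) //=; set t := (X in _ = _ + X).
suff -> : t = 0 by rewrite addn0.
rewrite /t big_nat_cond big1 // => k /andP[/andP[lt_nk _] _].
by rewrite divn_small // (ltn_trans lt_nk) // ltn_expl // prime_gt1.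
Qed.

(** * Valuations of Chebyshev's factorial quotient *)

Definition chebyshev_num (n : nat) : nat := (30 * n)`! * n`!.
Definition chebyshev_den (n : nat) : nat := (15 * n)`! * (10 * n)`! * (6 * n)`!.

Lemma chebyshev_num_gt0 (n : nat) : 0 < chebyshev_num n.
Proof. by rewrite muln_gt0 !fact_gt0. Qed.

Lemma chebyshev_den_gt0 (n : nat) : 0 < chebyshev_den n.
Proof. by rewrite !muln_gt0 !fact_gt0. Qed.

Lemma logn_chebyshev_num (p n : nat) : prime p -> logn p (chebyshev_num n) =
  \sum_(1 <= k < (30 * n).+1) ((30 * n) %/ p ^ k + (30 * n) %/ p ^ k %/ 30).
Proof.
move=> pr_p; rewrite lognM ?fact_gt0 // (@logn_factE _ (30 * n) (30 * n)) //.
rewrite (@logn_factE _ n (30 * n)) ?leq_pmull // -big_split /=.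
by apply: eq_bigr => k _; rewrite -divnMA [_ * 30]mulnC divnMl.
Qed.

Lemma logn_chebyshev_den (p n : nat) : prime p -> logn p (chebyshev_den n) =
  \sum_(1 <= k < (30 * n).+1) ((30 * n) %/ p ^ k %/ 2 +
     (30 * n) %/ p ^ k %/ 3 + (30 * n) %/ p ^ k %/ 5).
Proof.
move=> pr_p; rewrite !lognM ?muln_gt0 ?fact_gt0 //.
rewrite (@logn_factE _ (15 * n) (30 * n)) ?leq_mul //.
rewrite (@logn_factE _ (10 * n) (30 * n)) ?leq_mul //.
rewrite (@logn_factE _ (6 * n) (30 * n)) ?leq_mul // -!big_split /=.
apply: eq_bigr => k _; rewrite -!divnMA ![p ^ k * _]mulnC.
rewrite -[in X in X + _ + _](divnMl (p := 2)) //.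
rewrite -[in X in _ + X + _](divnMl (p := 3)) //.
by rewrite -[in X in _ + X](divnMl (p := 5)) // !mulnA.
Qed.

(* With [a = 30n %/ p ^ k] the two sides are the contributions of [p ^ k] to the
   valuations of the denominator and numerator of Chebyshev's quotient. *)
Lemma chebyshev_floor (a : nat) :
  a %/ 2 + a %/ 3 + a %/ 5 + (0 < a < 6) <= a + a %/ 30 <=
  a %/ 2 + a %/ 3 + a %/ 5 + (0 < a).
Proof. lia. Qed.

Lemma chebyshev_dvd_num (n : nat) :
  chebyshev_den n * \prod_((5 * n).+1 <= p < (30 * n).+1 | prime p) p
    %| chebyshev_num n.
Proof.
have -> : \prod_((5 * n).+1 <= p < (30 * n).+1 | prime p) p =
          \prod_((5 * n).+1 <= p < (30 * n).+1 | prime p) p ^ 1 by [].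
apply: dvdn_logn => [||p pr_p].
- by rewrite muln_gt0 chebyshev_den_gt0 (prod_primes_gt0 (fun=> 1)).
- exact: chebyshev_num_gt0.
rewrite lognM ?chebyshev_den_gt0 ?(prod_primes_gt0 (fun=> 1)) //.
rewrite (logn_prod_primes (fun=> 1)) // muln1.
rewrite logn_chebyshev_num // logn_chebyshev_den //.
case: (posnP n) => [->|n_gt0].
  by rewrite !muln0 !big_geq // add0n; case: p pr_p.
rewrite !(@big_ltn _ _ _ 1) ?ltnS ?muln_gt0 //= addnAC leq_add //; last first.
  apply: leq_sum => k _; have /andP[le_num _] := chebyshev_floor (30 * n %/ p ^ k).
  exact: leq_trans (leq_addr _ _) le_num.
rewrite expn1; have p_gt0 := prime_gt0 pr_p.
have /andP[le_num _] := chebyshev_floor (30 * n %/ p).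
apply: leq_trans le_num; rewrite leq_add2l.
(* For [5n < p <= 30n] the floor of [30n / p] lies between 1 and 5, the case in which
   [chebyshev_floor] leaves a surplus of one for [p] itself. *)
case: andP => // -[lt_p le_p]; rewrite divn_gt0 // -ltnS le_p /= ltn_divLR //.
by rewrite (_ : (_ < _) = true) //; lia.
Qed.

(** Each power [p ^ k <= 30n] adds at most one to the excess valuation and larger powers add
    nothing. The product on the right is the lcm of 1, ..., 30n. *)
Lemma chebyshev_num_dvd (n : nat) : chebyshev_num n %|
  chebyshev_den n *
    \prod_(1 <= p < (30 * n).+1 | prime p) p ^ trunc_log p (30 * n).
Proof.
apply: dvdn_logn => [||p pr_p].
- exact: chebyshev_num_gt0.
- by rewrite muln_gt0 chebyshev_den_gt0 prod_primes_gt0.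
rewrite lognM ?chebyshev_den_gt0 ?prod_primes_gt0 //.
rewrite logn_prod_primes // prime_gt0 //=.
rewrite logn_chebyshev_num // logn_chebyshev_den //.
set t := trunc_log _ _.
have -> : (p < (30 * n).+1) * t = t.
  case: ltnP => [_|lt_p]; first exact: mul1n.
  by rewrite /t [trunc_log _ _](_ : _ = 0) //; apply/eqP; rewrite trunc_log_eq0; lia.
have le_t : \sum_(1 <= k < (30 * n).+1) (k <= t) <= t.
  by rewrite sum_nat_leq geq_minr.
apply: leq_trans (leq_add (leqnn _) le_t).
rewrite -big_split /=; apply: leq_sum => k _.
have /andP[_ le_num] := chebyshev_floor (30 * n %/ p ^ k).
apply: leq_trans le_num _; rewrite leq_add2l.
rewrite divn_gt0 ?expn_gt0 ?prime_gt0 //; case: (leqP (p ^ k)) => // le_pk.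
by rewrite (trunc_log_max (prime_gt1 pr_p) le_pk).
Qed.

(** * The quotient compared with primorials *)

Lemma primorialE (m n : nat) : m <= n ->
  primorial n = primorial m * \prod_(m.+1 <= p < n.+1 | prime p) p.
Proof. by move=> le_mn; rewrite /primorial -big_cat_nat. Qed.

Lemma leq_primorial : {homo primorial : m n / m <= n}.
Proof.
move=> m n le_mn; rewrite (primorialE le_mn) leq_pmulr //.
exact: (prod_primes_gt0 (fun=> 1)).
Qed.

(** A prime [p > s] has [p ^ 2 > n], so it occurs with exponent at most one; each of the at most [s]
    remaining primes costs a factor [n.+1]. With [s] near the square root of [n] this cost is
    subexponential. *)
Lemma prod_trunc_log_leq (n s : nat) : n < s.+1 ^ 2 ->
  \prod_(1 <= p < n.+1 | prime p) p ^ trunc_log p n <= n.+1 ^ s * primorial n.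
Proof.
case: (posnP n) => [->|n_gt0 lt_ns].
  by rewrite big_geq // /primorial big_geq // exp1n.
apply: leq_trans (_ : \prod_(1 <= p < n.+1 | prime p) (n.+1 ^ (p <= s) * p) <= _).
  rewrite big_nat_cond [leqRHS]big_nat_cond; apply: leq_prod => p /andP[/andP[_ le_pn] pr_p].
  have p_gt1 := prime_gt1 pr_p.
  case: (leqP p s) => [_|lt_sp].
    apply: leq_trans (trunc_logP p_gt1 n_gt0) _.
    by rewrite expn1 -[n in n <= _]muln1 leq_mul // ltnW.
  rewrite expn0 mul1n -[leqRHS]expn1 leq_pexp2l ?(ltnW p_gt1) //.
  rewrite -ltnS -(ltn_exp2l _ _ p_gt1).
  apply: leq_ltn_trans (trunc_logP p_gt1 n_gt0) _.
  by apply: leq_trans lt_ns _; rewrite leq_exp2r.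
rewrite big_split /= leq_mul2r; apply/orP; right.
rewrite big_mkcond /=.
apply: leq_trans (_ : \prod_(1 <= p < n.+1) n.+1 ^ (p <= s) <= _).
  by apply: leq_prod => p _; case: ifP => // _; rewrite expn_gt0.
by rewrite -expn_sum sum_nat_leq leq_pexp2l // geq_minr.
Qed.

Lemma chebyshev_num_leq (n s : nat) : 30 * n < s.+1 ^ 2 ->
  chebyshev_num n <= chebyshev_den n * ((30 * n).+1 ^ s * primorial (30 * n)).
Proof.
move=> lt_ns; apply: leq_trans (dvdn_leq _ (chebyshev_num_dvd n)) _.
  by rewrite muln_gt0 chebyshev_den_gt0 prod_primes_gt0.
by rewrite leq_mul2l prod_trunc_log_leq ?orbT.
Qed.

Lemma chebyshev_num_geq (n : nat) :
  chebyshev_den n * primorial (30 * n) <= chebyshev_num n * primorial (5 * n).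
Proof.
have le_n : 5 * n <= 30 * n by rewrite leq_mul.
rewrite (primorialE le_n) mulnCA mulnC leq_mul2r.
by rewrite dvdn_leq ?orbT ?chebyshev_num_gt0 // chebyshev_dvd_num.
Qed.

(** * Growth of the quotient through binomial coefficients *)

Lemma fact_add (m n k : nat) : m + n = k -> k`! = 'C(k, m) * (m`! * n`!).
Proof. by move<-; rewrite -[in n`!](addKn m n) bin_fact ?leq_addr. Qed.

(** Writing the quotient with three binomial coefficients lets elementary entropy bounds replace
    Stirling's formula. *)
Lemma chebyshev_bin (n : nat) :
  chebyshev_num n * 'C(6 * n, 5 * n) =
  'C(30 * n, 15 * n) * 'C(15 * n, 10 * n) * chebyshev_den n.
Proof.
rewrite /chebyshev_num /chebyshev_den.
have -> : (30 * n)`! = 'C(30 * n, 15 * n) * ((15 * n)`! * (15 * n)`!).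
  by apply: fact_add; lia.
have -> : (6 * n)`! = 'C(6 * n, 5 * n) * ((5 * n)`! * n`!).
  by apply: fact_add; lia.
have: (15 * n)`! = 'C(15 * n, 10 * n) * ((10 * n)`! * (5 * n)`!).
  by apply: fact_add; lia.
move: ('C(30 * n, _)) ('C(15 * n, _)) ('C(6 * n, _)) => C1 C2 C3.
move: (15 * n)`! (10 * n)`! (5 * n)`! n`! => F15 F10 F5 F1 e.
transitivity (C1 * F15 * C3 * F1 * (C2 * (F10 * F5))); last ring.
rewrite -e; ring.
Qed.

(** The summand of the binomial expansion of [(a + b) ^ n], whose weights put the peak at the ratio
    [a : b]. *)
Definition entropy_term (a b n i : nat) : nat := 'C(n, i) * (a ^ i * b ^ (n - i)).

Lemma sum_entropy_term (a b n : nat) :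
  \sum_(i < n.+1) entropy_term a b n i = (a + b) ^ n.
Proof.
rewrite addnC expnDn.
by apply: eq_bigr => i _; rewrite /entropy_term [b ^ _ * _]mulnC.
Qed.

Lemma entropy_termS (a b n i : nat) : i < n ->
  i.+1 * b * entropy_term a b n i.+1 = (n - i) * a * entropy_term a b n i.
Proof.
move=> lt_in; rewrite /entropy_term -(subnSK lt_in) !expnS.
have := mul_bin_left n i; rewrite -(subnSK lt_in).
move: ('C(n, i.+1)) ('C(n, i)) (n - i.+1) => c d x e.
transitivity (i.+1 * c * (b * a * a ^ i * b ^ x)); first ring.
rewrite e; ring.
Qed.

(** By [entropy_termS], consecutive terms do not decrease up to the index [a * n] and do not
    increase after it. *)
Lemma leq_entropy_term (a b n i : nat) : 0 < a -> 0 < b -> i <= (a + b) * n ->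
  entropy_term a b ((a + b) * n) i <= entropy_term a b ((a + b) * n) (a * n).
Proof.
move=> a_gt0 b_gt0; set N := (a + b) * n => le_iN.
have defN : N = a * n + b * n by rewrite /N mulnDl.
have up k : k + a * n <= N ->
    entropy_term a b N (k + a * n) <= entropy_term a b N (a * n).
  elim: k => [|k IHk] //; rewrite addSn => lt_kN.
  apply: leq_trans (IHk (ltnW lt_kN)).
  have e := entropy_termS a b lt_kN.
  have bd : (N - (k + a * n)) * a <= (k + a * n).+1 * b by nia.
  have pos : 0 < (k + a * n).+1 * b by rewrite muln_gt0.
  by rewrite -(leq_pmul2l pos) e leq_mul2r bd orbT.
have down k : k <= a * n ->
    entropy_term a b N (a * n - k) <= entropy_term a b N (a * n).
  elim: k => [|k IHk lt_k]; first by rewrite subn0.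
  apply: leq_trans (IHk (ltnW lt_k)).
  have lt_N : a * n - k.+1 < N by lia.
  have := entropy_termS a b lt_N; rewrite subnSK // => e.
  have bd : (a * n - k) * b <= (N - (a * n - k.+1)) * a by nia.
  have pos : 0 < (N - (a * n - k.+1)) * a by rewrite muln_gt0 subn_gt0 lt_N.
  by rewrite -(leq_pmul2l pos) -e leq_mul2r bd orbT.
case: (leqP i (a * n)) => [le_i|/ltnW le_i].
  by rewrite -(subKn le_i); apply: down; rewrite leq_subr.
by rewrite -(subnK le_i); apply: up; rewrite subnK.
Qed.

Lemma bin_entropy_leq (a b n : nat) :
  'C((a + b) * n, a * n) * (a ^ (a * n) * b ^ (b * n)) <= (a + b) ^ ((a + b) * n).
Proof.
have lt_an : a * n < ((a + b) * n).+1 by rewrite ltnS leq_mul2r leq_addr orbT.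
rewrite -sum_entropy_term (bigD1 (Ordinal lt_an)) //= {1}/entropy_term.
by rewrite [in X in b ^ (X - _)]mulnDl addKn leq_addr.
Qed.

(** The largest of the [(a + b) * n + 1] summands is at least their average. *)
Lemma bin_entropy_geq (a b n : nat) : 0 < a -> 0 < b ->
  (a + b) ^ ((a + b) * n) <=
  ((a + b) * n).+1 * ('C((a + b) * n, a * n) * (a ^ (a * n) * b ^ (b * n))).
Proof.
move=> a_gt0 b_gt0.
have -> : b * n = (a + b) * n - a * n by rewrite mulnDl addKn.
rewrite -/(entropy_term _ _ _ _) -sum_entropy_term.
set m := entropy_term a b _ (a * n).
apply: (@leq_trans (\sum_(i < ((a + b) * n).+1) m)).
  by apply: leq_sum => i _; apply: leq_entropy_term; rewrite // -ltnS.
by rewrite sum_nat_const card_ord.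
Qed.

(* By Stirling's formula the base is [30^30 / (15^15 * 10^10 * 6^6)]. *)
Lemma chebyshev_growth : exists2 K : nat, 1 < K & forall n,
  K ^ n * chebyshev_den n <= (30 * n).+1 ^ 2 * chebyshev_num n /\
  chebyshev_num n <= (6 * n).+1 * (K ^ n * chebyshev_den n).
Proof.
exists (2 ^ 14 * 3 ^ 9 * 5 ^ 5) => [|n].
  by rewrite -[1]/(1 * 1 * 1) !ltn_mul // (ltn_expl _ 0).
have e30 : (1 + 1) * (15 * n) = 30 * n by lia.
have e15 : (2 + 1) * (5 * n) = 15 * n by lia.
have e10 : 2 * (5 * n) = 10 * n by lia.
(* The three binomials grow with bases [2^30], [3^15 / 2^10] and [6^6 / 5^5]; the first two
   multiplied and divided by the third give [K]. *)
have C1_le : 'C(30 * n, 15 * n) <= (2 ^ n) ^ 30.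
  have := bin_entropy_leq 1 1 (15 * n).
  by rewrite e30 mul1n !exp1n !muln1 -expnM [n * 30]mulnC.
have C1_ge : (2 ^ n) ^ 30 <= (30 * n).+1 * 'C(30 * n, 15 * n).
  have := @bin_entropy_geq 1 1 (15 * n) isT isT.
  by rewrite e30 mul1n !exp1n !muln1 -expnM [n * 30]mulnC.
have C2_le : 'C(15 * n, 10 * n) * (2 ^ n) ^ 10 <= (3 ^ n) ^ 15.
  have := bin_entropy_leq 2 1 (5 * n).
  by rewrite e15 e10 !exp1n !muln1 -!expnM [n * 10]mulnC [n * 15]mulnC.
have C2_ge : (3 ^ n) ^ 15 <= (15 * n).+1 * ('C(15 * n, 10 * n) * (2 ^ n) ^ 10).
  have := @bin_entropy_geq 2 1 (5 * n) isT isT.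
  by rewrite e15 e10 !exp1n !muln1 -!expnM [n * 10]mulnC [n * 15]mulnC.
have C3_le : 'C(6 * n, 5 * n) * (5 ^ n) ^ 5 <= (2 ^ n) ^ 6 * (3 ^ n) ^ 6.
  have := bin_entropy_leq 5 1 n.
  by rewrite !exp1n !muln1 -expnMn -expnMn -!expnM [n * 5]mulnC [n * 6]mulnC.
have C3_ge : (2 ^ n) ^ 6 * (3 ^ n) ^ 6 <=
    (6 * n).+1 * ('C(6 * n, 5 * n) * (5 ^ n) ^ 5).
  have := @bin_entropy_geq 5 1 n isT isT.
  by rewrite !exp1n !muln1 -expnMn -expnMn -!expnM [n * 5]mulnC [n * 6]mulnC.
have C3_gt0 : 0 < 'C(6 * n, 5 * n) by rewrite bin_gt0 leq_mul.
have -> : (2 ^ 14 * 3 ^ 9 * 5 ^ 5) ^ n =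
          (2 ^ n) ^ 14 * (3 ^ n) ^ 9 * (5 ^ n) ^ 5.
  by rewrite 2!expnMn (expnAC 2 14) (expnAC 3 9) (expnAC 5 5).
have := chebyshev_bin n; move: C1_le C1_ge C2_le C2_ge C3_le C3_ge C3_gt0.
have: 0 < 2 ^ n by rewrite expn_gt0.
have: (15 * n).+1 <= (30 * n).+1 by rewrite ltnS leq_mul.
move: ('C(30 * n, _)) ('C(15 * n, _)) ('C(6 * n, _)) (30 * n).+1 (15 * n).+1
  (6 * n).+1 (chebyshev_num n) (chebyshev_den n) (2 ^ n) (3 ^ n) (5 ^ n).
move=> C1 C2 C3 p q r num den a b c le_qp a_gt0 C1_le C1_ge C2_le C2_ge C3_le C3_ge
  C3_gt0 e.
have a10_gt0 : 0 < a ^ 10 by rewrite expn_gt0 a_gt0.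
split.
  have le1 := leq_trans (leq_mul C1_ge C2_ge)
    (leq_mul (leqnn _) (leq_mul le_qp (leqnn _))).
  (* Multiplying by [C3] and [2 ^ (10n)] clears the denominators. *)
  rewrite -(leq_pmul2r C3_gt0) -(leq_pmul2r a10_gt0).
  have -> : p ^ 2 * num * C3 * a ^ 10 = p * C1 * (p * (C2 * a ^ 10)) * den.
    transitivity (p ^ 2 * (num * C3) * a ^ 10); first ring.
    rewrite e; ring.
  apply: leq_trans (leq_mul le1 (leqnn den)).
  apply: leq_trans (_ : a ^ 24 * b ^ 9 * den * (C3 * c ^ 5) <= _).
    by apply: eq_leq; ring.
  apply: leq_trans (leq_mul (leqnn _) C3_le) _.
  by apply: eq_leq; ring.
rewrite -(leq_pmul2r C3_gt0) -(leq_pmul2r a10_gt0) e.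
apply: leq_trans (_ : C1 * (C2 * a ^ 10) * den <= _); first by apply: eq_leq; ring.
apply: leq_trans (leq_mul (leq_mul C1_le C2_le) (leqnn _)) _.
apply: leq_trans (_ : a ^ 24 * b ^ 9 * den * (a ^ 6 * b ^ 6) <= _).
  by apply: eq_leq; ring.
apply: leq_trans (leq_mul (leqnn _) C3_ge) _.
by apply: eq_leq; ring.
Qed.

(** * Primorial bounds and primes in short intervals *)

Lemma exp_dominates_pow (d : nat) : exists n0, forall n, n0 <= n -> n ^ d <= 2 ^ n.
Proof.
case: (posnP d) => [->|d_gt0]; first by exists 0 => n _; rewrite expn_gt0.
exists (2 * d * (2 * d)) => n le_n.
pose q := n %/ (2 * d).
have d2_gt0 : 0 < 2 * d by rewrite muln_gt0.
have le_dq : 2 * d <= q by rewrite leq_divRL.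
have le_nq : n <= (2 ^ q) ^ 2.
  apply: (@leq_trans (q.+1 ^ 2)); last by rewrite leq_exp2r // ltn_expl.
  apply: ltnW; apply: leq_trans (ltn_ceil n d2_gt0) _.
  by rewrite -/q expnS expn1 leq_mul2l ltnW ?orbT.
apply: leq_trans (_ : ((2 ^ q) ^ 2) ^ d <= _); first by rewrite leq_exp2r.
by rewrite -!expnM leq_exp2l // leq_trunc_div.
Qed.

(** Iterating [step] along [y, y/6, y/36, ...] gives the exponent [(1/30)(6/5) = 1/25] of [K ^ y].
    Using 24 instead of 25 leaves a spare factor [K ^ n] at each step, which absorbs the polynomial
    factor and the rounding loss [K ^ 30]. *)
Lemma primorial_upper (K : nat) : 1 < K ->
  (forall n, chebyshev_num n <= (6 * n).+1 * (K ^ n * chebyshev_den n)) ->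
  exists C, forall y, primorial y ^ 24 <= C * K ^ y.
Proof.
move=> K_gt1 num_le; have K_gt0 := ltnW K_gt1.
have step n : primorial (30 * n) <= (6 * n).+1 * K ^ n * primorial (5 * n).
  rewrite -(leq_pmul2l (chebyshev_den_gt0 n)).
  apply: leq_trans (chebyshev_num_geq n) _.
  apply: leq_trans (leq_mul (num_le n) (leqnn _)) _.
  by apply: eq_leq; ring.
have [n0 exp_dom] := exp_dominates_pow (2 * 24).
have poly_le n : n0 + 60 <= n -> (6 * n).+1 ^ 24 * K ^ 30 <= K ^ n.
  move=> le_n; have le30 : 30 <= n by lia.
  rewrite -[in leqRHS](subnK le30) expnD leq_mul2r; apply/orP; right.
  apply: leq_trans (_ : 2 ^ (n - 30) <= _); last by rewrite leq_exp2r //; lia.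
  apply: leq_trans (exp_dom _ _); last by lia.
  by rewrite expnM leq_exp2r // expnS expn1; nia.
(* The constant settles all small [y]; the induction step does not change it. *)
exists (primorial (30 * (n0 + 70)) ^ 24) => y.
elim/ltn_ind: y => y IHy.
case: (leqP y (30 * (n0 + 70))) => [le_y|lt_y].
  rewrite -[primorial y ^ 24]muln1 leq_mul ?expn_gt0 ?K_gt0 //.
  by rewrite leq_exp2r // leq_primorial.
pose n := (y %/ 30).+1.
have le_yn : y <= 30 * n by rewrite /n; lia.
have le_ny : 30 * n <= y + 30 by rewrite /n; lia.
have lt_ny : 5 * n < y by lia.
have le_n : n0 + 60 <= n by lia.
apply: leq_trans (_ : primorial (30 * n) ^ 24 <= _).
  by rewrite leq_exp2r // leq_primorial.
apply: leq_trans (_ : ((6 * n).+1 * K ^ n * primorial (5 * n)) ^ 24 <= _).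
  by rewrite leq_exp2r // step.
rewrite !expnMn; apply: leq_trans (leq_mul (leqnn _) (IHy _ lt_ny)) _.
move: (primorial _ ^ 24) => C.
rewrite mulnCA leq_mul2l; apply/orP; right.
rewrite -(@leq_pmul2r (K ^ 30)) ?expn_gt0 ?K_gt0 //.
apply: leq_trans (_ : (6 * n).+1 ^ 24 * K ^ 30 * ((K ^ n) ^ 24 * K ^ (5 * n)) <= _).
  by apply: eq_leq; ring.
apply: leq_trans (leq_mul (poly_le n le_n) (leqnn _)) _.
by rewrite -expnM -!expnD leq_pexp2l //; lia.
Qed.

Lemma floor_sqrt (n : nat) : exists s, s ^ 2 <= n < s.+1 ^ 2.
Proof.
elim: n => [|n [s /andP[le_sn lt_ns]]]; first by exists 0.
case: (ltnP n.+1 (s.+1 ^ 2)) => [lt_nS|le_nS].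
  by exists s; rewrite lt_nS (leq_trans le_sn).
by exists s.+1; rewrite le_nS; apply: leq_ltn_trans lt_ns _; rewrite ltn_exp2r.
Qed.

Lemma primorial_eq (m n : nat) :
  (forall p, prime p -> m < p -> ~~ (p <= n)) -> primorial n <= primorial m.
Proof.
move=> no_prime; case: (leqP n m) => [|/ltnW le_mn]; first exact: leq_primorial.
rewrite (primorialE le_mn) big_nat_cond big_pred0 ?muln1 // => p.
apply/negP => /andP[/andP[lt_mp le_pn] pr_p].
by have := no_prime p pr_p lt_mp; rewrite -ltnS le_pn.
Qed.

(** Raising to the power [312 = 24 * 13] bounds [K ^ (312m)] by [g ^ 312 * C ^ 13 * K ^ (13y)],
    where [13y] is at most [300m + 300]. The gain [12m] reflects [13/10 > 30/24]; [26 <= m] keeps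
    the subtraction from truncating. *)
Lemma primorial_gap_growth (K C P y m g : nat) : 1 < K ->
  13 * y <= 300 * m + 300 -> 26 <= m -> K ^ m <= g * P ->
  P ^ 24 <= C * K ^ y -> 2 ^ (12 * m - 300) <= g ^ 312 * C ^ 13.
Proof.
move=> K_gt1 le_y le_m le_Km le_P; have K_gt0 := ltnW K_gt1.
apply: leq_trans (_ : K ^ (12 * m - 300) <= _); first by rewrite leq_exp2r //; lia.
have e : 12 * m - 300 + (300 * m + 300) = m * (24 * 13) by lia.
rewrite -(@leq_pmul2r (K ^ (300 * m + 300))) ?expn_gt0 ?K_gt0 // -expnD e.
apply: leq_trans (_ : (g ^ 24 * (C * K ^ y)) ^ 13 <= _).
  rewrite 2!expnM leq_exp2r //.
  by apply: leq_trans (leq_mul (leqnn _) le_P); rewrite -expnMn leq_exp2r.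
rewrite 2!expnMn -!expnM mulnA; apply: leq_mul => //.
by rewrite leq_pexp2l // mulnC.
Qed.

(** The error factor to the power 312 is thus at most about [2 ^ (n / 4)]; for [n = 30m] this is
    [2 ^ (7.5m)], below the gain [2 ^ (12m)]. *)
Lemma sqrt_pow_growth (n s : nat) : n < s.+1 ^ 2 ->
  s.+1 ^ (2 * 312 * 4) <= 2 ^ s.+1 ->
  ((n.+1 ^ (s + 2)) ^ 312) ^ 4 <= 2 ^ (s.+1 * (s + 2)).
Proof.
move=> lt_ns exp_dom; rewrite [leqRHS]expnM.
apply: leq_trans (_ : (((s.+1 ^ 2) ^ (s + 2)) ^ 312) ^ 4 <= _).
  by rewrite !leq_exp2r // addn2.
rewrite (expnAC _ (s + 2)) (expnAC _ (s + 2)) leq_exp2r ?addn2 //.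
by rewrite -!expnM mulnA.
Qed.

Lemma prime_in_interval : exists y0, forall y, y0 <= y ->
  exists p, [/\ prime p, y < p & 10 * p <= 13 * y].
Proof.
have [K K_gt1 K_growth] := chebyshev_growth.
have [C C_upper] := primorial_upper K_gt1 (fun n => proj2 (K_growth n)).
have [n0 exp_dom] := exp_dominates_pow (2 * 312 * 4).
(* [T] bounds [s] from below; it dominates both [n0] and the constants of the final comparison. *)
pose T := 300 * (C + 30) + n0; exists (T ^ 2 + 300) => y le_y.
case: (boolP (has (fun p => prime p && (y < p)) (iota 0 (13 * y %/ 10).+1))).
  case/hasP=> p; rewrite mem_iota add0n /= ltnS => le_p /andP[pr_p lt_yp].
  by exists p; split=> //; lia.
move/hasPn=> no_prime; exfalso.
pose m := 13 * y %/ 300.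
(* Without a prime in the interval the primorial stays constant up to [30m <= 13y / 10]. *)
have le_P : primorial (30 * m) <= primorial y.
  apply: primorial_eq => p pr_p lt_yp; apply/negP => le_p.
  have lt_p : p < (13 * y %/ 10).+1 by rewrite /m in le_p; lia.
  by have := no_prime p; rewrite mem_iota add0n lt_p pr_p lt_yp => /(_ isT).
have [s /andP[le_s lt_s]] := floor_sqrt (30 * m).
have T_lt : T < s.+1.
  rewrite -(ltn_exp2r _ _ (isT : 0 < 2)); apply: leq_ltn_trans lt_s.
  by rewrite /m; lia.
(* The exponent [s] comes from the small primes, the 2 from the lower growth bound. *)
have le_Km : K ^ m <= (30 * m).+1 ^ (s + 2) * primorial y.
  apply: leq_trans (leq_mul (leqnn _) le_P).
  rewrite -(leq_pmul2r (chebyshev_den_gt0 m)).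
  apply: leq_trans (proj1 (K_growth m)) _.
  apply: leq_trans (leq_mul (leqnn _) (chebyshev_num_leq lt_s)) _.
  by apply: eq_leq; rewrite expnD; ring.
have le_m : 26 <= m by rewrite /m; lia.
have le_ym : 13 * y <= 300 * m + 300 by rewrite /m; lia.
have le_2 := primorial_gap_growth K_gt1 le_ym le_m le_Km (C_upper y).
have n0_le : n0 <= s.+1 by clear - T_lt; rewrite /T in T_lt; lia.
have le_g := sqrt_pow_growth lt_s (exp_dom _ n0_le).
move: {le_Km} ((30 * m).+1 ^ (s + 2)) le_g le_2 => g le_g le_2.
have: 2 ^ ((12 * m - 300) * 4) <= 2 ^ (s.+1 * (s + 2) + C * 13 * 4).
  rewrite expnM; apply: leq_trans (_ : (g ^ 312 * C ^ 13) ^ 4 <= _).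
    by rewrite leq_exp2r.
  rewrite expnMn [leqRHS]expnD leq_mul //.
  by rewrite 2![in leqRHS]expnM !leq_exp2r // ltnW // ltn_expl.
rewrite leq_exp2l // => {}le_2; rewrite /T in T_lt.
(* By [s ^ 2 <= 30m], the left exponent [48m] is at least [(8/5) s ^ 2]; leading coefficients 8 and
   5 then contradict [s >= T]. *)
have: 8 * s ^ 2 <= 5 * (s.+1 * (s + 2) + C * 13 * 4 + 1200).
  by clear - le_2 le_s; lia.
by clear - T_lt; nia.
Qed.

(** * Even elements of the prime semigroups and the two-prime sum *)

Lemma leq_nth_prime : {homo nth_prime : m n / m <= n}.
Proof. by apply: homo_leq => [//|m n p|n]; [exact: leq_trans|exact/ltnW/nth_prime_lt]. Qed.

Lemma nth_prime_onto (p : nat) : prime p -> exists2 n, 0 < n & nth_prime n = p.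
Proof.
move=> pr_p; have exn : exists n, p <= nth_prime n.
  exists p; elim: p {pr_p} => // p IHp; exact: leq_ltn_trans IHp (nth_prime_lt p).
case: (ex_minnP exn) => -[|n] le_pn min_n.
  by move: le_pn; rewrite leqNgt prime_gt0.
exists n.+1 => //; apply/eqP; rewrite eqn_leq le_pn andbT nth_prime_gap //.
by rewrite ltnNge; apply/negP => /min_n; rewrite ltnn.
Qed.

Lemma frobenius_number_lt (n x : nat) : 0 < n ->
  frobenius_number (prime_semigroup n) < x -> prime_semigroup n x.
Proof.
move=> n_gt0 lt_fx; have [_ max_f] := frobenius_numberP n_gt0.
by apply: contrapT => /max_f; rewrite leqNgt lt_fx.
Qed.

(* Four generators already exceed [x], and three odd ones have an odd sum. *)
Lemma prime_semigroup_even (n x : nat) : 2 < nth_prime n -> 2 < x ->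
  x < 4 * nth_prime n -> ~~ odd x -> prime_semigroup n x ->
  exists p q, [/\ prime p, prime q, x = p + q, nth_prime n <= p & p <= q].
Proof.
move=> p_gt2 x_gt2 lt_x even_x [s sP def_x].
have odd_s q : q \in s -> [/\ prime q, nth_prime n <= q & odd q].
  move=> /sP /andP[pr_q le_q]; split=> //.
  by case: (even_prime pr_q) => // q2; move: le_q; rewrite q2 leqNgt p_gt2.
case: s sP def_x odd_s => [|a [|b [|c [|d s]]]] _ /= def_x odd_s.
- by rewrite def_x in x_gt2.
- have [_ _ odd_a] := odd_s a (mem_head _ _).
  by move: even_x; rewrite def_x addn0 odd_a.
- have [pr_a le_a _] := odd_s a (mem_head _ _).
  have [|pr_b le_b _] := odd_s b; first by rewrite !inE eqxx orbT.
  case: (leqP a b) => [le_ab|/ltnW le_ba].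
    by exists a, b; split; rewrite // def_x addn0.
  by exists b, a; split; rewrite // def_x addn0 addnC.
- have [_ _ odd_a] := odd_s a (mem_head _ _).
  have [|_ _ odd_b] := odd_s b; first by rewrite !inE eqxx orbT.
  have [|_ _ odd_c] := odd_s c; first by rewrite !inE eqxx !orbT.
  by move: even_x; rewrite def_x addn0 !oddD odd_a odd_b odd_c.
- have [_ le_a _] := odd_s a (mem_head _ _).
  have [|_ le_b _] := odd_s b; first by rewrite !inE eqxx orbT.
  have [|_ le_c _] := odd_s c; first by rewrite !inE eqxx !orbT.
  have [|_ le_d _] := odd_s d; first by rewrite !inE eqxx !orbT.
  by move: lt_x; rewrite ltnNge def_x; case/negP; lia.
Qed.

Local Open Scope classical_set_scope.
Local Open Scope ring_scope.

Theorem proposition2 (R : realType)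
    (hlim : (fun n : nat => (frobenius_number (prime_semigroup n))%:R
                              / (nth_prime n)%:R : R) @ \oo --> (3 : R)) :
  exists N : nat, forall x : nat, (N <= x)%N -> ~~ odd x ->
    exists p q : nat,
      [/\ prime p, prime q, x = (p + q)%N
        & x%:R / 4 < p%:R :> R /\ p%:R <= x%:R / 2 :> R].
Proof.
(* The threshold fits the interval: [(61/20)(13/10)(x/4) = (793/800) x < x]. *)
have lt3 : (3 : R) < 61 / 20 by lra.
have [n0 _ lt_f] := cvgr_lt _ hlim _ lt3.
have [y0 gapP] := prime_in_interval.
(* This makes [x %/ 4] at least [y0], and the prime [r] above it larger than both 2 and
   [nth_prime n0], so that its index reaches [n0]. *)
exists (4 * (y0 + nth_prime n0 + 2))%N => x le_x even_x.
have [|r [pr_r lt_yr le_r]] := gapP (x %/ 4)%N; first by lia.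
have [n n_gt0 def_r] := nth_prime_onto pr_r.
have r_gt0 : (0 : R) < r%:R by rewrite ltr0n prime_gt0.
have le_n0n : (n0 <= n)%N.
  by rewrite leqNgt; apply/negP => /ltnW/leq_nth_prime; rewrite def_r; lia.
have lt_fr : (20 * frobenius_number (prime_semigroup n) < 61 * r)%N.
  have := lt_f n le_n0n; rewrite /= def_r ltr_pdivrMr // => lt_fr.
  by rewrite -(ltr_nat R) !natrM; lra.
have [||||p [q [pr_p pr_q def_x le_np le_pq]]] := @prime_semigroup_even n x _ _ _ even_x _.
- by rewrite def_r; lia.
- by lia.
- by rewrite def_r; lia.
- by apply: frobenius_number_lt; lia.
exists p, q; split=> //.
have : (x < 4 * p)%N by lia.
have : (2 * p <= x)%N by lia.
by rewrite -(ler_nat R) -(ltr_nat R) !natrM; lra.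
Qed.
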